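(* Let $k,n$ be positive integers and let $\vec p=(p_1,\dots,p_k)$ with $p_i>0$ and $\sum_i p_i=1$. Let $\alpha$ be any optimal mixed strategy for $n$-token competitive Knock 'em Down with die probabilities $\vec p$. Then $\alpha$ assigns probability $0$ to the set of allocations $\vec\xi$ whose overplay $\max_i\left(\frac{\xi_i}{p_i}-n\right)$ is greater than $$\frac{3\sqrt{3+\sqrt5}\,\sqrt{kn}+1}{\min_i p_i}.$$
   Context: $n$-token competitive Knock 'em Down: an allocation is a vector $\vec\xi=(\xi_1,\dots,\xi_k)$ of nonnegative integers with $\sum_i\xi_i=n$ ($\xi_i$ is the number of tokens placed in bin $i$). A $k$-sided die showing side $i$ with probability $p_i$ is thrown independently at the points of a rate-1 Poisson process, so the numbers $Y_{i,t}$ of occurrences of side $i$ up to time $t$ form independent Poisson processes with rates $p_i$. Each occurrence of side $i$ removes one token from bin $i$ (if nonempty), so bin $i$ is cleared at time $T_i=\inf\{t\ge 0: Y_{i,t}\ge \xi_i\}$. The clearance time of $\vec\xi$ is $T_{\vec\xi}=\max_i T_i$. Two players choose allocations without seeing each other's choice, and the same die throws are used for both players. The event ''$\vec\xi$ beats $\vec\eta$'' is that $T_{\vec\xi}<T_{\vec\eta}$, or that $T_{\vec\xi}=T_{\vec\eta}$ and $\vec\xi$ wins an independent fair coin toss. A mixed strategy is a probability distribution on allocations. For mixed strategies $\alpha,\beta$, $\Pr[\alpha\text{ beats }\beta]$ is the probability that $\vec\xi$ beats $\vec\eta$ when $\vec\xi\sim\alpha$ and $\vec\eta\sim\beta$ are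 drawn independently of each other and of the die throws. A mixed strategy $\alpha$ is optimal if there is no mixed strategy $\beta$ with $\Pr[\beta\text{ beats }\alpha]>\Pr[\alpha\text{ beats }\beta]$. *)

(* Defs.v *)
From HB Require Import structures.
From mathcomp Require Import all_boot all_order all_algebra.
From mathcomp Require Import all_classical all_reals all_analysis.

Set Implicit Arguments.
Unset Strict Implicit.
Unset Printing Implicit Defensive.

Import Order.TTheory GRing.Theory Num.Theory.
Import numFieldNormedType.Exports.

Local Open Scope classical_set_scope.
Local Open Scope ring_scope.

Definition mutually_independent (d : measure_display) (Omega : measurableType d)
    (R : realType) (P : probability Omega R) (I : choiceType)
    (F : I -> set (set Omega)) : Prop :=
  forall (s : seq I) (A : I -> set Omega), uniq s ->
    (forall i, i \in s -> F i (A i)) ->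
    P (\bigcap_(i in [set` s]) A i) = (\prod_(i <- s) P (A i))%E.

(* A rate-1 Poisson process is given by its i.i.d. Exp(1) gaps W 0, W 1, ...,
   and the die throw D j takes place at its j-th point W 0 + ... + W j. *)
Record die_at_poisson_times (d : measure_display) (Omega : measurableType d)
    (R : realType) (P : probability Omega R) (k : nat) (p : 'I_k -> R)
    (W : nat -> {RV P >-> R}) (D : nat -> Omega -> 'I_k) : Prop := {
  gap_law : forall (j : nat) (B : set R), measurable B ->
    distribution P (W j) B = exponential_prob 1 B;
  throw_measurable : forall (j : nat) (i : 'I_k),
    measurable [set w | D j w = i];
  throw_law : forall (j : nat) (i : 'I_k), P [set w | D j w = i] = (p i)%:E;
  gaps_throws_independent :
    mutually_independent P (fun x : (nat + nat)%type =>
      match x with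
      | inl j => [set W j @^-1` B | B in [set B : set R | measurable B]]
      | inr j => [set D j @^-1` S | S in [set: set 'I_k]]
      end)
}.

Definition throw_time (T : Type) (R : realType) (W : nat -> T -> R)
    (j : nat) (w : T) : R :=
  \sum_(l < j.+1) W l w.

(* Y_{i,t}; a priori possibly infinite, on a null set of outcomes. *)
Definition occurrences (T : Type) (R : realType) (k : nat)
    (W : nat -> T -> R) (D : nat -> T -> 'I_k) (i : 'I_k) (t : R) (w : T)
    : \bar R :=
  (\sum_(0 <= j <oo)
     ((throw_time W j w <= t) && (D j w == i))%:R%:E)%E.

(* The bound by n on each entry follows from the sum, and makes the type
   finite. *)
Definition allocation (k n : nat) : predArgType :=
  {xi : {ffun 'I_k -> 'I_n.+1} | (\sum_(i < k) xi i == n)%N}.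

Definition tokens (k n : nat) (xi : allocation k n) (i : 'I_k) : nat :=
  val xi i.

Definition bin_time (T : Type) (R : realType) (k n : nat)
    (W : nat -> T -> R) (D : nat -> T -> 'I_k) (xi : allocation k n)
    (i : 'I_k) (w : T) : \bar R :=
  ereal_inf [set t%:E | t in
    [set t : R | 0 <= t /\ ((tokens xi i)%:R%:E <= occurrences W D i t w)%E]].

Definition clearance_time (T : Type) (R : realType) (k n : nat)
    (W : nat -> T -> R) (D : nat -> T -> 'I_k) (xi : allocation k n)
    (w : T) : \bar R :=
  \big[maxe/-oo%E]_(i < k) bin_time W D xi i w.

(* The second component of an outcome is the result of the coin toss. *)
Definition beats (T : Type) (R : realType) (k n : nat)
    (W : nat -> T -> R) (D : nat -> T -> 'I_k) (xi eta : allocation k n)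
    : set (T * bool) :=
  [set wc | (clearance_time W D xi wc.1 < clearance_time W D eta wc.1)%E \/
            (clearance_time W D xi wc.1 = clearance_time W D eta wc.1 /\
             wc.2 = true)].

Definition mixed_strategy (R : realType) (k n : nat)
    (alpha : allocation k n -> R) : Prop :=
  (forall xi, 0 <= alpha xi) /\ \sum_(xi : allocation k n) alpha xi = 1.

Definition pr_beats (d : measure_display) (Omega : measurableType d)
    (R : realType) (P : probability Omega R) (k n : nat)
    (W : nat -> {RV P >-> R}) (D : nat -> Omega -> 'I_k)
    (alpha beta : allocation k n -> R) : R :=
  \sum_(xi : allocation k n) \sum_(eta : allocation k n)
    alpha xi * beta eta *
    fine ((P \x bernoulli_prob (2^-1 : R))%E (beats W D xi eta)).

Definition optimal (d : measure_display) (Omega : measurableType d)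
    (R : realType) (P : probability Omega R) (k n : nat)
    (W : nat -> {RV P >-> R}) (D : nat -> Omega -> 'I_k)
    (alpha : allocation k n -> R) : Prop :=
  mixed_strategy alpha /\
  ~ (exists beta : allocation k n -> R, mixed_strategy beta /\
       pr_beats W D beta alpha > pr_beats W D alpha beta).

(* Extrema over the sides of the die; for k > 0 the neutral elements do not
   contribute and the values are finite. *)
Definition max_over (R : realType) (k : nat) (f : 'I_k -> R) : R :=
  fine (\big[maxe/-oo%E]_(i < k) (f i)%:E).

Definition min_over (R : realType) (k : nat) (f : 'I_k -> R) : R :=
  fine (\big[mine/+oo%E]_(i < k) (f i)%:E).

Definition overplay (R : realType) (k n : nat) (p : 'I_k -> R)
    (xi : allocation k n) : R :=
  max_over (fun i => (tokens xi i)%:R / p i - n%:R).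

(* Main.v *)
Require Import Defs.
From mathcomp Require Import all_boot all_order all_algebra.
From mathcomp Require Import all_classical all_reals all_analysis.
From mathcomp Require Import ring lra zify.

Import Order.TTheory GRing.Theory Num.Theory.
Import numFieldNormedType.Exports.

Local Open Scope ring_scope.

(* Let [q] be the least [p i] and call [M zeta xi] the difference between the
   probabilities that [zeta] beats [xi] and that [xi] beats [zeta].

   If the overplay of [xi] exceeds that of [zeta] by [u] and is attained in
   bin [i], then [xi] can be cleared no later than [zeta] only if, for some
   [j != i], side [i] shows [xi i] times before side [j] shows [zeta j] times.
   By Chebyshev's inequality this has probability at most
   [(xi i + zeta j) / (q u)^2], so that [M zeta xi >= y := 1 - 2 k n / (q u)^2].

   Let [xi] have overplay [1 / q + 3 u] and positive weight in the optimal
   strategy [alpha]. Split the mass of [alpha] into the part [L] of overplay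
   less than [1 / q + u], the part [H] of overplay more than [1 / q + 2 u] and
   the rest [A]. No strategy beats [alpha]. Played against it,
   - a balanced allocation, of overplay at most [1 / q], gives
     [L >= y (A + H)];
   - [xi], which by complementary slackness breaks even, gives
     [H >= y (L + A)];
   - the restriction of [alpha] to [L], which is even with itself, gives
     [A >= y H].
   Together [y^2 + y <= 1], while [u > sqrt (3 + sqrt 5) sqrt (k n) / q] makes
   [y] greater than the inverse [(sqrt 5 - 1) / 2] of the golden ratio. *)

Set Implicit Arguments.
Unset Strict Implicit.

(** * Finite symmetric zero-sum games with graded strategies *)

Lemma skew_game_overplay (R : realFieldType) (T : finType) (M : T -> T -> R)
    (o alpha : T -> R) (u y o0 : R) (eta xi : T) :
  (forall z x, M z x = - M x z) -> (forall z x, M z x <= 1) ->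
  (forall z, 0 <= alpha z) -> (forall z, \sum_x alpha x * M z x <= 0) ->
  0 < y -> 1 < y ^+ 2 + y -> 0 < u ->
  (forall z x, o z + u <= o x -> y <= M z x) ->
  o eta <= o0 -> o xi = o0 + 3 * u -> alpha xi = 0.
Proof.
move=> Mskew M1 a0 opt y0 yg u0 gap oeta oxi.
have [//|axi] := eqVneq (alpha xi) 0.
have {}axi : 0 < alpha xi by rewrite lt_neqAle eq_sym axi a0.
(* Complementary slackness: by antisymmetry [alpha] is even with itself, and as no summand is
   positive, each one vanishes. *)
have total : \sum_z alpha z * (\sum_x alpha x * M z x) = 0.
  set S := LHS; suff: S = - S by lra.
  rewrite {1}/S; under eq_bigr do rewrite mulr_sumr.
  rewrite exchange_big -sumrN; apply: eq_bigr => x _.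
  rewrite mulr_sumr -sumrN; apply: eq_bigr => z _.
  by rewrite (Mskew z x); ring.
have slack z : alpha z * (\sum_x alpha x * M z x) = 0.
  apply: oppr_inj; rewrite oppr0.
  apply: (@psumr_eq0P _ _ xpredT
    (fun z => - (alpha z * \sum_x alpha x * M z x))) => //.
    by move=> w _; rewrite oppr_ge0 mulr_ge0_le0.
  by rewrite sumrN total oppr0.
pose lo x := o x < o0 + u; pose hi x := o0 + 2 * u < o x.
pose L := \sum_(x | lo x) alpha x.
pose A := \sum_(x | ~~ lo x && ~~ hi x) alpha x.
pose H := \sum_(x | ~~ lo x && hi x) alpha x.
have split3 c1 c2 c3 : \sum_x alpha x *
    (if lo x then c1 else if hi x then c3 else c2) = c1 * L + c2 * A + c3 * H.
  rewrite (bigID lo) /= -addrA; congr (_ + _).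
    by rewrite mulr_sumr; apply: eq_bigr => x ->; ring.
  rewrite (bigID hi) /= addrC; congr (_ + _); rewrite mulr_sumr.
    by apply: eq_bigr => x /andP[/negbTE-> /negbTE->]; ring.
  by apply: eq_bigr => x /andP[/negbTE-> ->]; ring.
have M_ge z x : -1 <= M z x by rewrite Mskew lerN2.
have eqL : y * (A + H) <= L.
  suff: (-1) * L + y * A + y * H <= 0 by lra.
  rewrite -split3; apply: le_trans (opt eta).
  apply: ler_sum => x _; apply: ler_wpM2l => //.
  case: ifPn => [//|]; rewrite -leNgt => ox.
  by rewrite if_same; apply: gap; lra.
have eqH : y * (L + A) <= H.
  have /eqP := slack xi; rewrite mulf_eq0 gt_eqF //= => /eqP xi0.
  suff: (0 <= (- y) * L + (- y) * A + 1 * H) by lra.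
  rewrite -split3 -[leLHS]xi0; apply: ler_sum => x _; apply: ler_wpM2l => //.
  case: ifPn => [ox|nlo].
    by rewrite Mskew lerN2; apply: gap; rewrite /lo in ox; lra.
  case: ifPn => [//|]; rewrite -leNgt => ox.
  by rewrite Mskew lerN2; apply: gap; lra.
have xi_hi : ~~ lo xi && hi xi by rewrite /lo /hi oxi; apply/andP; split; lra.
have H0 : 0 < H.
  apply: (lt_le_trans axi); rewrite /H (bigD1 xi) //= lerDl.
  by apply: sumr_ge0.
have A0 : 0 <= A by apply: sumr_ge0.
have L0 : 0 < L by apply: lt_le_trans eqL; apply: mulr_gt0 => //; lra.
have eqA : y * H <= A.
  (* The restriction of [alpha] to [lo] is left unnormalised, of mass [L]: its payoff against itself
     is zero, that against the other two layers at least [L * (y * H - A)]. *)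
  suff: L * (y * H - A) <= 0 by rewrite pmulr_rle0 // subr_le0.
  have self : \sum_(z | lo z) \sum_(x | lo x) alpha z * alpha x * M z x = 0.
    set S := LHS; suff: S = - S by lra.
    rewrite {1}/S exchange_big -sumrN; apply: eq_bigr => x _.
    by rewrite -sumrN; apply: eq_bigr => z _; rewrite (Mskew z x); ring.
  have: \sum_(z | lo z) alpha z * \sum_x alpha x * M z x <= 0.
    by apply: sumr_le0 => z _; apply: mulr_ge0_le0.
  apply: le_trans; rewrite [leRHS](_ : _ = \sum_(z | lo z)
      (\sum_(x | lo x) alpha z * alpha x * M z x +
       alpha z * \sum_(x | ~~ lo x) alpha x * M z x)); last first.
    apply: eq_bigr => z _; rewrite (bigID lo) /= mulrDr mulr_sumr.
    by congr (_ + _); apply: eq_bigr => x _; rewrite mulrA.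
  rewrite big_split /= self add0r mulr_suml; apply: ler_sum => z zlo.
  apply: ler_wpM2l => //; rewrite (bigID hi) /= mulr_sumr -sumrN.
  apply: lerD; apply: ler_sum => x /andP[xlo xhi].
    rewrite mulrC; apply: ler_wpM2l => //; apply: gap.
    by rewrite /lo in zlo; rewrite /hi in xhi; lra.
  by rewrite -mulrN1; apply: ler_wpM2l.
(* Chaining [eqH], [eqL] and [eqA] gives [(y ^+ 3 + 2 * y ^+ 2) * H <= H], whereas
   [y ^+ 3 + 2 * y ^+ 2 - 1] factors as [(y + 1) * (y ^+ 2 + y - 1)]. *)
have y3 : 0 < y * (y ^+ 2 + y - 1) + (y ^+ 2 + y - 1).
  by apply: addr_gt0; first apply: mulr_gt0; lra.
have : 0 < H * (y * (y ^+ 2 + y - 1) + (y ^+ 2 + y - 1)) by apply: mulr_gt0.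
nra.
Qed.

(** * Races between two sides in a finite random word *)

Section WordMean.
Context (R : pzRingType) (I : finType) (p : I -> R).

(** Expectation over [m] independent throws, as a finite recursion on the first throw, so that races
    can be bounded by induction without measure theory. *)
Fixpoint word_mean (m : nat) (f : seq I -> R) : R :=
  if m is m'.+1 then \sum_x p x * word_mean m' (fun w => f (x :: w))
  else f [::].
End WordMean.

(* In the word [w], side [j] does not occur [b] times before side [i] has
   occurred [a] times; a word too short to decide counts as lost. *)
Fixpoint loses (I : eqType) (i j : I) (a b : nat) (w : seq I) : bool :=
  if b == 0%N then false else if a == 0%N then true
  else if w is x :: w' then loses i j (a - (x == i)) (b - (x == j)) w'
  else true.

Lemma word_mean_const (R : pzRingType) (I : finType) (p : I -> R) m (c : R) :
  \sum_x p x = 1 -> word_mean p m (fun=> c) = c.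
Proof.
move=> p1; elim: m => //= m IH.
by under eq_bigr do rewrite IH; rewrite -mulr_suml p1 mul1r.
Qed.

Lemma loses_r0 (I : eqType) (i j : I) a w : loses i j a 0 w = false.
Proof. by case: w. Qed.

Lemma loses_l0 (I : eqType) (i j : I) b w : loses i j 0 b.+1 w = true.
Proof. by case: w. Qed.

(** The prefix ends where [j] completes its [b] occurrences. When [i = j], one letter could bring
    both counters to zero, and [loses] tests [b] first; [b < a] excludes this tie. *)
Lemma lead_prefix (I : eqType) (i j : I) (a b : nat) (w : seq I) :
  (0 < a)%N -> (i = j -> (b < a)%N) -> ~~ loses i j a b w ->
  exists2 l, (l <= size w)%N &
    (b <= count_mem j (take l w))%N /\ (count_mem i (take l w) < a)%N.
Proof.
elim: w a b => [|x w IH] a b a0 ij; rewrite /= ?[a == _]eqn0Ngt ?a0 /=.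
  by case: eqP => // -> _; exists 0%N.
case: eqP => [-> _|/eqP b0]; first by exists 0%N => //=; rewrite take0.
have [a1|] := posnP (a - (x == i)).
  case b1: (b - (x == j))%N => [|b']; last by rewrite a1 loses_l0.
  have xi : x = i by apply/eqP; case: eqP a1 a0 => //; lia.
  have xj : x = j by apply/eqP; case: eqP b1 b0 => //; lia.
  have := ij (etrans (esym xi) xj); rewrite xi -xj xi eqxx in a1 b1 *; lia.
move=> a1 /IH[] //; first by move=> e; have := ij e; rewrite e; lia.
move=> l lw [hb ha]; exists l.+1 => //=; split; lia.
Qed.

Section Bounds.
Context (R : realFieldType) (I : finType) (p : I -> R).
Hypotheses (p_gt0 : forall i, 0 < p i) (p1 : \sum_i p i = 1).

Lemma die_prob_le1 j : p j <= 1.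
Proof. by rewrite -p1 (bigD1 j) //= lerDl sumr_ge0 // => i _; exact: ltW. Qed.

Lemma mean_const_but_one j (f : I -> R) (c : R) :
  (forall x, x != j -> f x = c) ->
  \sum_x p x * f x = p j * f j + (1 - p j) * c.
Proof.
move=> fc; rewrite (bigD1 j) //= -p1 [X in _ + (X - _) * _](bigD1 j) //=.
rewrite addrAC subrr add0r.
by rewrite mulr_suml; congr (_ + _); apply: eq_bigr => x /fc ->.
Qed.

(** Here only a word too short can lose. The bound is Markov's inequality for [2] to the power of
    the number of missing occurrences: each throw halves it with probability [p i]. *)
Lemma word_mean_loses_self i a b m : (b < a)%N ->
  word_mean p m (fun w => (loses i i a b w)%:R) <= 2 ^+ b * (1 - p i / 2) ^+ m.
Proof.
have r0 : 0 <= 1 - p i / 2 by have := die_prob_le1 i; lra.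
elim: m a b => [|m IH] a [|b] ba.
- by rewrite /= ltW // expr0 mulr1.
- rewrite /= gtn_eqF ?(ltn_trans _ ba) // expr0 mulr1.
  by rewrite exprn_ege1 // ler1n.
- rewrite (_ : word_mean _ _ _ = 0) ?mulr_ge0 ?exprn_ge0 //.
  rewrite -[RHS](word_mean_const m.+1 0 p1); congr word_mean.
  by apply/funext => w; rewrite loses_r0.
case: a ba => // a ba.
have step x : word_mean p m (fun w => (loses i i a.+1 b.+1 (x :: w))%:R) <=
    2 ^+ (b.+1 - (x == i)) * (1 - p i / 2) ^+ m by apply: IH; lia.
apply: le_trans (ler_sum _ (fun x _ => ler_wpM2l (ltW (p_gt0 x)) (step x))) _.
rewrite (@mean_const_but_one i _ (2 ^+ b.+1 * (1 - p i / 2) ^+ m)); last first.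
  by move=> x /negbTE ->; rewrite subn0.
rewrite eqxx subSS subn0 !exprS le_eqVlt; apply/orP; left; apply/eqP; by field.
Qed.

(** The first term is Chebyshev's bound for the race run to its end; the second bounds the
    probability that [j] shows fewer than [b] times in [m] throws. *)
Lemma word_mean_loses i j a b m : i != j -> p i * b%:R < p j * a%:R ->
  word_mean p m (fun w => (loses i j a b w)%:R) <=
  p i * p j * (a + b)%:R / (p j * a%:R - p i * b%:R) ^+ 2 +
  2 ^+ b * (1 - p j / 2) ^+ m.
Proof.
move=> ij; rewrite -subr_gt0; set D := p j * a%:R - _ => D0.
have r0 : 0 <= 1 - p j / 2 by have := die_prob_le1 j; lra.
(* With [a] and [b] occurrences of [i] and [j] missing, [p i * b - p j * a] is
   a martingale; [G] is the normalised second moment of its final value, a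
   harmonic function that is at least [1] where [i] has won. *)
pose G a b := ((p i * b%:R - p j * a%:R + D) ^+ 2 + p i * p j * (a + b)%:R)
  / D ^+ 2.
have G0 a' b' : 0 <= G a' b'.
  by rewrite divr_ge0 ?sqr_ge0 // addr_ge0 ?sqr_ge0 // !mulr_ge0 // ltW.
suff bound a' b' : word_mean p m (fun w => (loses i j a' b' w)%:R) <=
    G a' b' + 2 ^+ b' * (1 - p j / 2) ^+ m.
  have /le_trans := bound a b; apply; rewrite lerD2r /G /D.
  by rewrite addrA subrK subrr expr0n add0r.
elim: m a' b' => [|m IH] a' [|b'].
- by rewrite /= addr_ge0 // mulr_ge0 // ?exprn_ge0.
- by rewrite /= if_same expr0 mulr1 ler_wpDl // exprn_ege1 // ler1n.
- rewrite (_ : word_mean _ _ _ = 0).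
    by apply: addr_ge0 => //; rewrite mulr_ge0 // exprn_ge0.
  rewrite -[RHS](word_mean_const m.+1 0 p1); congr word_mean.
  by apply/funext => w; rewrite loses_r0.
case: a' => [|a'].
  rewrite (_ : word_mean _ _ _ = 1); last first.
    rewrite -[RHS](word_mean_const m.+1 1 p1); congr word_mean.
    by apply/funext => w; rewrite loses_l0.
  apply: ler_wpDr; first by rewrite mulr_ge0 // exprn_ge0.
  rewrite /G ler_pdivlMr ?exprn_gt0 // mul1r mulr0 subr0 ler_wpDr //.
    by rewrite !mulr_ge0 // ltW.
  have pb0 : 0 <= p i * b'.+1%:R by rewrite mulr_ge0 // ltW.
  rewrite ler_pXn2r ?nnegrE ?(ltW D0) ?(addr_ge0 pb0 (ltW D0)) //.
  by rewrite -subr_ge0 addrK.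
have step x : word_mean p m (fun w => (loses i j a'.+1 b'.+1 (x :: w))%:R) <=
    G (a'.+1 - (x == i))%N (b'.+1 - (x == j))%N +
    2 ^+ (b'.+1 - (x == j)) * (1 - p j / 2) ^+ m by exact: IH.
apply: le_trans (ler_sum _ (fun x _ => ler_wpM2l (ltW (p_gt0 x)) (step x))) _.
under eq_bigr do rewrite mulrDr.
rewrite big_split /=.
rewrite [X in _ + X](@mean_const_but_one j _
  (2 ^+ b'.+1 * (1 - p j / 2) ^+ m)); last first.
  by move=> x /negbTE ->; rewrite subn0.
have ji : j != i by rewrite eq_sym.
have rest : \sum_(x | (x != i) && (x != j)) p x = 1 - p i - p j.
  by rewrite -p1 [in RHS](bigD1 i) //= [in RHS](bigD1 j) //=; ring.
rewrite (bigD1 i) //= (bigD1 j) //= !eqxx (negbTE ij) (negbTE ji).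
rewrite [X in _ + (_ + X)](_ : _ = (1 - p i - p j) * G a'.+1 b'.+1); last first.
  rewrite -rest mulr_suml; apply: eq_bigr => x /andP[/negbTE xi /negbTE xj].
  by rewrite xi xj !subn0.
(* Equality holds: the martingale gains [p j] with probability [p i] and loses [p i] with
   probability [p j], so its expected square grows by [p i * p j * (p i + p j)], just what the
   linear term of [G] loses. *)
rewrite !subSS !subn0 /G !exprS !natrD -!natr1.
rewrite le_eqVlt; apply/orP; left; apply/eqP; field; by rewrite gt_eqF.
Qed.
End Bounds.

(** * Extrema over the sides and allocations close to proportional *)

Lemma max_over_attained (R : realType) (k : nat) (f : 'I_k -> R) : (0 < k)%N ->
  exists2 i, max_over f = f i & forall j, f j <= f i.
Proof.
move=> k0; have [i _ fi] := @Order.TotalTheory.arg_maxP _ R 'I_k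
  (Ordinal k0) xpredT f isT.
exists i => [|j]; last exact: fi.
rewrite /max_over (_ : \big[_/_]_(_ < _) _ = (f i)%:E) //.
apply/le_anti/andP; split; last by apply: (le_bigmax _ (fun i => (f i)%:E) i).
by apply/bigmax_leP; split=> [|j _]; [exact: leNye|rewrite lee_fin; exact: fi].
Qed.

Lemma min_over_attained (R : realType) (k : nat) (f : 'I_k -> R) : (0 < k)%N ->
  exists2 i, min_over f = f i & forall j, f i <= f j.
Proof.
move=> k0; have [i _ fi] := @Order.TotalTheory.arg_minP _ R 'I_k
  (Ordinal k0) xpredT f isT.
exists i => [|j]; last exact: fi.
rewrite /min_over (_ : \big[_/_]_(_ < _) _ = (f i)%:E) //.
apply/le_anti/andP; split; first by apply: bigmin_le_cond.
by apply/bigmin_geP; split=> [|j _]; [exact: leey|rewrite lee_fin; exact: fi].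
Qed.

Lemma sum_tokens (k n : nat) (xi : allocation k n) :
  (\sum_(i < k) tokens xi i = n)%N.
Proof. exact/eqP/(valP xi). Qed.

Lemma tokens_le (k n : nat) (xi : allocation k n) i : (tokens xi i <= n)%N.
Proof. by rewrite -ltnS ltn_ord. Qed.

(* Rounding the partial sums of [n * p] down, rather than its entries, keeps
   the total equal to [n]. *)
Lemma balanced_allocation (R : realType) (k n : nat) (p : 'I_k -> R) :
  (forall i, 0 < p i) -> \sum_(i < k) p i = 1 ->
  exists eta : allocation k n, forall i, (tokens eta i)%:R <= n%:R * p i + 1.
Proof.
move=> p0 p1.
pose S l := n%:R * \sum_(i < k | (i < l)%N) p i.
have S0 l : 0 <= S l by rewrite mulr_ge0 // sumr_ge0 // => i _; exact: ltW.
have SS (i : 'I_k) : S i.+1 = S i + n%:R * p i.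
  rewrite /S (bigD1 i) //= mulrDr addrC; congr (_ + _); congr (_ * _).
  by apply: eq_bigl => j; rewrite ltnS ltn_neqAle andbC.
pose c l := Num.truncn (S l).
have cS (i : 'I_k) : (c i <= c i.+1)%N.
  by apply: le_truncn; rewrite SS lerDl mulr_ge0 // ltW.
have Sk : S k = n%:R.
  rewrite /S -[RHS]mulr1 -p1; congr (_ * _); apply: eq_bigl => i.
  exact: ltn_ord.
have sumc m : (m <= k)%N -> (\sum_(i < m) (c i.+1 - c i) = c m)%N.
  elim: m => [_|m IH mk].
    by rewrite big_ord0 /c /S big_pred0 // mulr0 truncn0.
  by rewrite big_ord_recr /= IH ?(ltnW mk) // subnKC // (cS (Ordinal mk)).
have ck : c k = n by rewrite /c Sk natrK.
have cn (i : 'I_k) : (c i.+1 - c i < n.+1)%N.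
  rewrite ltnS -[leqRHS]ck -(sumc k) // (bigD1 i) //= leq_addr //.
pose eta := [ffun i : 'I_k => Ordinal (cn i)].
have etaP : (\sum_(i < k) eta i == n)%N.
  apply/eqP; rewrite -[RHS]ck -(sumc k) //.
  by apply: eq_bigr => i _; rewrite ffunE.
exists (exist _ eta etaP) => i; rewrite /tokens /= ffunE /=.
have /andP[a1 a2] := truncn_itv (S0 i.+1).
have /andP[b1 b2] := truncn_itv (S0 i).
rewrite natrB //; rewrite -/(c _) -natr1 SS in a1 a2 b1 b2 *; lra.
Qed.

(** * Product measure and the law of finite words of throws *)

Section ProductMeasure.
Local Open Scope classical_set_scope.

(* [A] and [B] need not be measurable: the integral of a nonnegative function
   is a supremum over the simple functions below it. *)
Lemma le_product_measure1 (d1 d2 : measure_display) (T1 : measurableType d1)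
    (T2 : measurableType d2) (R : realType) (P : {measure set T1 -> \bar R})
    (Q : {measure set T2 -> \bar R}) (A B : set (T1 * T2)) :
  (forall X : set T2, measurable X) -> A `<=` B ->
  ((P \x Q)%E A <= (P \x Q)%E B)%E.
Proof.
move=> mT2 AB; rewrite /product_measure1 !ge0_integralTE //.
apply: le_ereal_sup => _ [h hA <-]; exists h => // x.
apply: le_trans (hA x) _ => /=; apply: le_measure; rewrite ?inE //.
by move=> y; rewrite /xsection /= !inE; exact: AB.
Qed.
End ProductMeasure.

Definition word (T : Type) (k : nat) (D : nat -> T -> 'I_k) (l m : nat) (w : T)
  : seq 'I_k := [seq D j w | j <- iota l m].

Section Words.
Local Open Scope classical_set_scope.
Context (d : measure_display) (Omega : measurableType d) (R : realType).
Context (P : probability Omega R) (k : nat) (p : 'I_k -> R).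
Context (W : nat -> {RV P >-> R}) (D : nat -> Omega -> 'I_k).
Hypothesis dieP : die_at_poisson_times p W D.

Lemma word_event_step (b : pred (seq 'I_k)) l m :
  [set w | b (word D l m.+1 w)] = \big[setU/set0]_(x < k)
    ([set w | D l w = x] `&` [set w | b (x :: word D l.+1 m w)]).
Proof.
rewrite -bigcup_seq; apply/seteqP; split => w /=.
  by move=> bw; exists (D l w) => //=; rewrite mem_index_enum.
by move=> [x _ [/= <-]].
Qed.

Lemma measurable_word (b : pred (seq 'I_k)) l m :
  measurable [set w | b (word D l m w)].
Proof.
elim: m b l => [|m IH] b l.
  rewrite (_ : [set w | _] = if b [::] then setT else set0); first by case: ifP.
  by apply/seteqP; split => w /=; rewrite /word /=; case: (b [::]).
rewrite word_event_step; apply: bigsetU_measurable => x _.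
apply: measurableI; first exact: throw_measurable dieP _ _.
exact: (IH (fun s => b (x :: s))).
Qed.

Lemma measurable_word_eq (v : seq 'I_k) l m :
  measurable [set w | word D l m w = v].
Proof.
rewrite [X in measurable X](_ : _ = [set w | word D l m w == v]).
  exact: (measurable_word (pred1 v)).
by apply/seteqP; split => w /= /eqP.
Qed.

Lemma prob_word_eq (v : seq 'I_k) :
  P [set w | word D 0 (size v) w = v] = (\prod_(x <- v) p x)%:E.
Proof.
(* A nonempty word supplies its first letter as the default value of [nth]. *)
case: v => [|x0 v'].
  rewrite big_nil (_ : [set w | _] = setT) ?probability_setT //.
  by apply/seteqP.
move: (x0 :: v') => {}v.
pose A (s : nat + nat) : set Omega :=
  if s is inr j then [set w | D j w = nth x0 v j] else setT.
have := gaps_throws_independent dieP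
  (s := [seq (inr j : (nat + nat)%type) | j <- iota 0 (size v)]) (A := A).
rewrite map_inj_uniq ?iota_uniq; last by move=> ? ? [].
move=> /(_ isT) indep.
have -> : [set w | word D 0 (size v) w = v] =
    \bigcap_(s in
      [set` [seq (inr j : (nat + nat)%type) | j <- iota 0 (size v)]]) A s.
  apply/seteqP; split => w /=.
    move=> wv s /= /mapP[j]; rewrite mem_iota add0n => /= jv -> /=.
    rewrite -[in RHS]wv (nth_map 0%N) ?size_iota // nth_iota //.
  move=> cap; apply: (@eq_from_nth _ x0); first by rewrite size_map size_iota.
  move=> j; rewrite size_map size_iota => jv.
  rewrite (nth_map 0%N) ?size_iota // nth_iota // add0n.
  by apply: (cap (inr j)) => /=; apply/mapP; exists j; rewrite ?mem_iota.
rewrite {}indep; last first.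
  move=> s /mapP[j _ ->] /=; exists [set nth x0 v j] => //.
rewrite big_map (big_nth x0) -prodEFin /index_iota subn0.
by apply: eq_bigr => j _; rewrite (throw_law dieP).
Qed.

(** Carrying a fixed prefix [v] makes the induction on [m] move one letter at a time from the tail
    into [v], so that independence enters only through [prob_word_eq]. *)
Lemma prob_prefix_word (b : pred (seq 'I_k)) (v : seq 'I_k) m :
  P ([set w | word D 0 (size v) w = v] `&` [set w | b (word D (size v) m w)]) =
  (\prod_(x <- v) p x * word_mean p m (fun s => (b s)%:R))%:E.
Proof.
elim: m b v => [|m IH] b v.
  rewrite (_ : [set w | b _] = if b [::] then setT else set0); last first.
    by apply/seteqP; split => w /=; rewrite /word /=; case: (b [::]).
  case: (boolP (b [::])) => /= [->|/negbTE->].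
    by rewrite setIT mulr1 prob_word_eq.
  by rewrite setI0 measure0 mulr0.
rewrite word_event_step big_distrr /= measure_bigsetU_ord //=; last 2 first.
- move=> x; apply: measurableI; first exact: measurable_word_eq.
  apply: measurableI; first exact: throw_measurable dieP _ _.
  exact: (measurable_word (fun s => b (x :: s))).
- by move=> x y _ _ [w [[_ [/= <- _]] [_ [/= <- _]]]].
rewrite mulr_sumr -sumEFin; apply: eq_bigr => x _.
have := IH (fun s => b (x :: s)) (rcons v x).
rewrite -cats1 big_cat big_seq1 /= size_cat addn1 mulrA => <-.
congr (P _); rewrite setIA; congr (_ `&` _).
have wS w : word D 0 (size v).+1 w = rcons (word D 0 (size v) w) (D (size v) w).
  by rewrite /word -addn1 iotaD map_cat cats1.
apply/seteqP; split => w /=; rewrite wS cats1; first by case=> -> ->.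
by move=> /rcons_inj[].
Qed.

Lemma prob_word (b : pred (seq 'I_k)) m :
  P [set w | b (word D 0 m w)] = (word_mean p m (fun s => (b s)%:R))%:E.
Proof.
have := prob_prefix_word b [::] m; rewrite big_nil mul1r => <-.
by congr (P _); apply/seteqP; split => w //= -[].
Qed.

(** The exponential density is supported on the nonnegative reals, so the integral reduces to one
    over the single point [0]. *)
Lemma prob_gap_le0 j : P [set w | W j w <= 0] = 0%E.
Proof.
have := gap_law dieP j (B := `]-oo, 0]%classic).
rewrite /distribution /pushforward /exponential_prob => /(_ (measurable_itv _)).
rewrite (_ : W j @^-1` _ = [set w | W j w <= 0]); last first.
  by apply/seteqP; split => w /=; rewrite in_itv.
move=> ->.
rewrite (_ : (fun x => _) =
  (fun x => (1 * expR (- 1 * x))%:E) \_ `[0, +oo[%classic).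
  rewrite -integral_mkcondr (_ : _ `&` _ = [set 0]) ?integral_set1 //.
  apply/seteqP; split => x /=; rewrite !in_itv /= andbT.
    by move=> [x0 x1]; apply/le_anti/andP.
  by move=> ->.
by apply/funext => x; rewrite /exponential_pdf !patchE; case: ifP.
Qed.

Lemma measurable_gap_le0 j : measurable [set w | W j w <= 0].
Proof.
rewrite [X in measurable X](_ : _ = W j @^-1` `]-oo, 0]%classic).
  exact: measurable_funPTI.
by apply/seteqP; split => w /=; rewrite in_itv.
Qed.

Lemma negligible_gap : P (\bigcup_j [set w | W j w <= 0]) = 0%E.
Proof.
apply/eqP; rewrite eq_le measure_ge0 andbT.
apply: le_trans (measure_sigma_subadditive _ _ _ (@subset_refl _ _)) _.
- exact: measurable_gap_le0.
- by apply: bigcupT_measurable; exact: measurable_gap_le0.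
by rewrite eseries0 // => j _ _; exact: prob_gap_le0.
Qed.
End Words.

(** * Clearance times for one outcome with positive gaps *)

Section Times.
Context (T : Type) (R : realType) (k n : nat).
Context (W : nat -> T -> R) (D : nat -> T -> 'I_k) (w : T).
Hypothesis W_gt0 : forall j, 0 < W j w.

Lemma throw_time_lt i j : (i < j)%N -> throw_time W i w < throw_time W j w.
Proof.
apply: (homo_ltn (r := <%R) (f := fun j => throw_time W j w)) => {i j}.
  exact: lt_trans.
by move=> j; rewrite /throw_time [ltRHS]big_ord_recr ltrDl.
Qed.

Lemma throw_time_le i j : (i <= j)%N -> throw_time W i w <= throw_time W j w.
Proof. by rewrite leq_eqVlt => /predU1P[->//|/throw_time_lt/ltW]. Qed.

Lemma throw_time_gt0 j : 0 < throw_time W j w.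
Proof.
apply: (@lt_le_trans _ _ (throw_time W 0 w)); last exact: throw_time_le.
by rewrite /throw_time big_ord1.
Qed.

Lemma count_word (i : 'I_k) l :
  (\sum_(0 <= j < l) ((D j w == i)%:R : R)%:E)%E =
  ((count_mem i (word D 0 l w))%:R)%:E.
Proof.
rewrite sumEFin; congr EFin; rewrite -natr_sum; congr (_%:R).
rewrite /word count_map -sum1_count [RHS]big_mkcond /index_iota subn0.
by apply: eq_bigr => j _ /=; case: eqP.
Qed.

Lemma bin_time_le (xi : allocation k n) (i : 'I_k) l (u : R) : 0 <= u ->
  (forall j, (j < l)%N -> throw_time W j w <= u) ->
  (tokens xi i <= count_mem i (word D 0 l w))%N ->
  (bin_time W D xi i w <= u%:E)%E.
Proof.
move=> u0 ul xil; apply: ereal_inf_lbound; exists u => //=; split => //.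
apply: le_trans (nneseries_lim_ge l _); last by move=> j _ _; rewrite lee_fin.
rewrite big_nat (eq_bigr (fun j => ((D j w == i)%:R : R)%:E)); last first.
  by move=> j /ul ->.
by rewrite -big_nat count_word lee_fin ler_nat.
Qed.

(** Throws are numbered from zero: before [throw_time W l w] only the first [l] have occurred, so
    the rest of the series vanishes. *)
Lemma bin_time_ge (xi : allocation k n) (i : 'I_k) l :
  (count_mem i (word D 0 l w) < tokens xi i)%N ->
  ((throw_time W l w)%:E <= bin_time W D xi i w)%E.
Proof.
move=> xil; apply: le_ereal_inf_tmp => _ [t [t0 tt] <-].
rewrite lee_fin leNgt; apply/negP => tl; move: tt; apply/negP; rewrite -ltNge.
rewrite /occurrences (nneseries_split _ l) => [|j _]; last by rewrite lee_fin.
rewrite add0n [X in (_ + X)%E]eseries0 ?adde0 => [|j lj _]; last first.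
  by rewrite leNgt (lt_le_trans tl) // throw_time_le.
apply: (@le_lt_trans _ _ ((count_mem i (word D 0 l w))%:R)%:E).
  rewrite -count_word; apply: lee_sum => j _; rewrite lee_fin ler_nat.
  by case: (_ <= _).
by rewrite lte_fin ltr_nat.
Qed.

Lemma clearance_time_lt (xi zeta : allocation k n) (i : 'I_k) l :
  (forall j, (tokens zeta j <= count_mem j (word D 0 l w))%N) ->
  (count_mem i (word D 0 l w) < tokens xi i)%N ->
  (clearance_time W D zeta w < clearance_time W D xi w)%E.
Proof.
move=> hz hx.
have tx : ((throw_time W l w)%:E <= clearance_time W D xi w)%E.
  apply: le_trans (bin_time_ge hx) _.
  exact: (le_bigmax _ (fun i => bin_time W D xi i w) i).
apply: lt_le_trans tx.
(* The time of the last of the first [l] throws, or time zero if there are none. *)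
pose u : R := if l is l'.+1 then throw_time W l' w else 0.
apply: (@le_lt_trans _ _ u%:E); last first.
  rewrite /u; case: (l) => [|l']; rewrite lte_fin ?throw_time_gt0 //.
  exact: throw_time_lt.
apply/bigmax_leP; split=> [|j _]; first exact: leNye.
apply: bin_time_le (hz j) => [|j' jl].
  by rewrite /u; case: (l) => // l'; rewrite ltW // throw_time_gt0.
by rewrite /u; case: (l) jl => // l' jl; exact: throw_time_le.
Qed.

(** Each [j] yields a prefix that clears bin [j] of [zeta] but not bin [i] of [xi]; the longest of
    these prefixes clears all of [zeta] and still not bin [i] of [xi]. *)
Lemma clearance_time_race (xi zeta : allocation k n) (i : 'I_k) m :
  (tokens zeta i < tokens xi i)%N ->
  (forall j, ~~ loses i j (tokens xi i) (tokens zeta j) (word D 0 m w)) ->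
  (clearance_time W D zeta w < clearance_time W D xi w)%E.
Proof.
move=> zxi race.
have prefix j : exists l : nat,
    (tokens zeta j <= count_mem j (word D 0 l w))%N /\
    (count_mem i (word D 0 l w) < tokens xi i)%N.
  have [||l lm hl] := lead_prefix _ _ (race j).
  - exact: leq_ltn_trans zxi.
  - by move=> <-.
  exists l; move: hl; rewrite /word -map_take take_iota.
  by move: lm; rewrite size_map size_iota => /minn_idPl ->.
have {prefix}[L LP] := choice prefix.
have k0 : (0 < #|'I_k|)%N by rewrite card_ord (leq_ltn_trans _ (ltn_ord i)).
have [j0 Lmax] := bigop.eq_bigmax L k0.
apply: (@clearance_time_lt xi zeta i (L j0)); last by have [] := LP j0.
move=> j; have [+ _] := LP j; move/leq_trans; apply.
have Lj : (L j <= L j0)%N by rewrite -Lmax leq_bigmax.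
by rewrite -(subnKC Lj) /word iotaD map_cat count_cat leq_addr.
Qed.
End Times.

(** * Win probabilities and the payoff forced by a difference in overplay *)

Lemma sum_pure (R : pzRingType) (I : finType) (z : I) (g : I -> R) :
  \sum_x (x == z)%:R * g x = g z.
Proof.
rewrite (bigD1 z) //= eqxx mul1r big1 ?addr0 // => x /negbTE ->.
by rewrite mul0r.
Qed.

Section Gap.
Local Open Scope classical_set_scope.
Context (d : measure_display) (Omega : measurableType d) (R : realType).
Context (P : probability Omega R) (k n : nat) (p : 'I_k -> R).
Context (W : nat -> {RV P >-> R}) (D : nat -> Omega -> 'I_k).
Hypothesis dieP : die_at_poisson_times p W D.

Definition win_prob (xi eta : allocation k n) : R :=
  fine ((P \x bernoulli_prob (2^-1 : R))%E (beats W D xi eta)).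

Lemma product_coin (S : set Omega) : measurable S ->
  (P \x bernoulli_prob (2^-1 : R))%E (S `*` setT) = P S.
Proof.
move=> mS.
by rewrite product_measure1E // [X in (_ * X)%E]probability_setT mule1.
Qed.

Lemma win_probE (xi eta : allocation k n) : (win_prob xi eta)%:E =
  (P \x bernoulli_prob (2^-1 : R))%E (beats W D xi eta).
Proof.
rewrite /win_prob fineK // ge0_fin_numE; last exact: integral_ge0.
apply: le_lt_trans (ltry 1).
rewrite -(probability_setT P) -product_coin //.
exact: le_product_measure1.
Qed.

Lemma win_prob_ge0 (xi eta : allocation k n) : 0 <= win_prob xi eta.
Proof. by rewrite fine_ge0 // integral_ge0. Qed.

Lemma win_prob_le1 (xi eta : allocation k n) : win_prob xi eta <= 1.
Proof.
rewrite -lee_fin win_probE -(probability_setT P) -product_coin //.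
exact: le_product_measure1.
Qed.

Lemma pr_beats_purel (z : allocation k n) (alpha : allocation k n -> R) :
  pr_beats W D (fun y => (y == z)%:R) alpha = \sum_y alpha y * win_prob z y.
Proof.
rewrite -(sum_pure z (fun x => \sum_y alpha y * win_prob x y)).
apply: eq_bigr => x _; rewrite mulr_sumr; apply: eq_bigr => y _.
by rewrite mulrA.
Qed.

Lemma pr_beats_purer (z : allocation k n) (alpha : allocation k n -> R) :
  pr_beats W D alpha (fun y => (y == z)%:R) = \sum_y alpha y * win_prob y z.
Proof.
apply: eq_bigr => x _.
rewrite -(sum_pure z (fun y => alpha x * win_prob x y)).
by apply: eq_bigr => y _; rewrite mulrCA mulrA.
Qed.

(** The two [beats] events are compared with the cylinders over the complement of [S] and over [S],
    whatever the coin shows. *)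
Lemma win_prob_gap (xi zeta : allocation k n) (S : set Omega) :
  measurable S ->
  (forall w, ~ S w ->
     (clearance_time W D zeta w < clearance_time W D xi w)%E) ->
  1 - 2 * fine (P S) <= win_prob zeta xi - win_prob xi zeta.
Proof.
move=> mS Slt; have PS : P S \is a fin_num by exact: fin_num_measure.
have win : 1 - fine (P S) <= win_prob zeta xi.
  rewrite -lee_fin win_probE EFinB fineK // -probability_setC //.
  rewrite -product_coin; last exact: measurableC.
  apply: le_product_measure1 => // -[w c] /= [nS _]; left; exact: Slt.
have lose : win_prob xi zeta <= fine (P S).
  rewrite -lee_fin win_probE fineK // -product_coin //.
  apply: le_product_measure1 => // -[w c] /= bt; split=> //.
  apply: contrapT => /Slt lt; case: bt => [/lt_trans/(_ lt)|[eq _]].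
    by rewrite ltxx.
  by rewrite eq ltxx in lt.
by rewrite mulrDl mul1r opprD addrA lerB.
Qed.

Hypotheses (p_gt0 : forall i, 0 < p i) (p1 : \sum_(i < k) p i = 1).

(** The gap gives [p j * a - p i * b >= p i * p j * u], so Chebyshev's term is at most
    [(a + b) / (p i * p j * u ^+ 2)]. For [j = i] only the term for short words remains. *)
Lemma prob_loses i j (a b : nat) (q u : R) m :
  0 < q -> 0 < u -> (forall j, q <= p j) -> b%:R / p j + u <= a%:R / p i ->
  fine (P [set w | loses i j a b (word D 0 m w)]) <=
  (j != i)%:R * (a + b)%:R / (q * u) ^+ 2 + 2 ^+ b * (1 - q / 2) ^+ m.
Proof.
move=> q0 u0 qp gap; rewrite (prob_word dieP) /=.
have geom : 2 ^+ b * (1 - p j / 2) ^+ m <= 2 ^+ b * (1 - q / 2) ^+ m.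
  have pj1 := die_prob_le1 p_gt0 p1 j; have qj := qp j.
  by rewrite ler_wpM2l // lerXn2r ?nnegrE //; lra.
have pi0 := p_gt0 i; have pj0 := p_gt0 j.
have D_ge : p i * p j * u <= p j * a%:R - p i * b%:R.
  rewrite -(ler_pM2l (mulr_gt0 pi0 pj0)) in gap.
  have e1 : p i * p j * (b%:R / p j + u) = p i * b%:R + p i * p j * u.
    by field; lra.
  have e2 : p i * p j * (a%:R / p i) = p j * a%:R by field; lra.
  lra.
have Du0 : 0 < p i * p j * u by rewrite !mulr_gt0.
have [ji|ji] := eqVneq j i; last first.
  apply: le_trans (word_mean_loses p_gt0 p1 _ _ _) _; first by rewrite eq_sym.
    by lra.
  apply: lerD => //; rewrite mul1r.
  apply: (@le_trans _ _ (p i * p j * (a + b)%:R / (p i * p j * u) ^+ 2)).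
    apply: ler_wpM2l; first by rewrite !mulr_ge0 // ltW.
    have Dge0 := lt_le_trans Du0 D_ge.
    by rewrite lef_pV2 ?posrE ?exprn_gt0 // lerXn2r ?nnegrE // ltW.
  have -> : p i * p j * (a + b)%:R / (p i * p j * u) ^+ 2 =
      (a + b)%:R / (p i * p j * u ^+ 2).
    by field; rewrite !gt_eqF.
  apply: ler_wpM2l => //.
  rewrite lef_pV2 ?posrE; last 2 first.
  - by rewrite !mulr_gt0 // exprn_gt0.
  - by rewrite exprn_gt0 // mulr_gt0.
  rewrite exprMn expr2 ler_pM2r ?exprn_gt0 //.
  by apply: ler_pM => //; exact: ltW.
rewrite !mul0r add0r; apply: le_trans geom; rewrite ji.
apply: word_mean_loses_self => //.
rewrite -(ltr_nat R); rewrite ji in D_ge Du0.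
by rewrite -(ltr_pM2l pi0); lra.
Qed.

Lemma win_prob_overplay (xi zeta : allocation k n) i (q u : R) :
  0 < q -> 0 < u -> (forall j, q <= p j) ->
  (forall j, (tokens zeta j)%:R / p j + u <= (tokens xi i)%:R / p i) ->
  1 - 2 * ((k * n)%:R / (q * u) ^+ 2) <= win_prob zeta xi - win_prob xi zeta.
Proof.
move=> q0 u0 qp gap.
pose C : R := \sum_(j < k) 2 ^+ tokens zeta j.
have bound m : 1 - 2 * ((k * n)%:R / (q * u) ^+ 2 + C * (1 - q / 2) ^+ m) <=
    win_prob zeta xi - win_prob xi zeta.
  pose B j := [set w | loses i j (tokens xi i) (tokens zeta j) (word D 0 m w)].
  pose N := \bigcup_j [set w | W j w <= 0].
  have mN : measurable N.
    by apply: bigcupT_measurable; exact: measurable_gap_le0.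
  have mB j : measurable (B j).
    exact: (measurable_word dieP (loses i j (tokens xi i) (tokens zeta j))).
  pose S := N `|` \big[setU/set0]_(j < k) B j.
  have mU : measurable (\big[setU/set0]_(j < k) B j).
    exact: bigsetU_measurable.
  have mS : measurable S by exact: measurableU.
  have subadd A A' : measurable A -> measurable A' ->
    (P (A `|` A') <= P A + P A')%E by exact: measureU2.
  have PS : fine (P S) <= \sum_(j < k) fine (P (B j)).
    rewrite -lee_fin fineK ?fin_num_measure //.
    apply: le_trans (subadd _ _ mN mU) _.
    rewrite (negligible_gap dieP) add0e -sumEFin.
    suff: measurable (\big[setU/set0]_(j < k) B j) /\
      (P (\big[setU/set0]_(j < k) B j) <=
       \sum_(j < k) (fine (P (B j)))%:E)%E by case.
    apply: (big_ind2 (fun A (x : \bar R) => measurable A /\ (P A <= x)%E)).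
    - by rewrite measure0.
    - move=> A x A' x' [mA Ax] [mA' Ax']; split; first exact: measurableU.
      by apply: le_trans (subadd _ _ mA mA') _; exact: leeD.
    - by move=> j _; rewrite fineK ?fin_num_measure.
  apply: le_trans (win_prob_gap mS _); last first.
    move=> w nS; apply: (@clearance_time_race _ _ _ _ _ _ _ _ _ _ i m).
    - move=> j; rewrite ltNge; apply/negP => Wj; apply: nS; left; by exists j.
    - have pVi : 0 < (p i)^-1 by rewrite invr_gt0.
      rewrite -(ltr_nat R) -(ltr_pM2r pVi).
      by apply: lt_le_trans (gap i); rewrite ltrDl.
    - move=> j; apply/negP => lj; apply: nS; right.
      by rewrite -bigcup_seq; exists j => //=; rewrite mem_index_enum.
  rewrite lerD2l lerN2 ler_pM2l //; apply: le_trans PS _.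
  apply: le_trans (ler_sum _ (fun j _ => prob_loses m q0 u0 qp (gap j))) _.
  rewrite big_split /= -mulr_suml lerD //; last by rewrite -mulr_suml.
  (* Over the [k.-1] sides other than [i], the terms [tokens xi i] add up to at most [k.-1 * n] and
     the terms [tokens zeta j] to at most [n], hence [k * n]. *)
  rewrite ler_wpM2r ?invr_ge0 ?sqr_ge0 //.
  under eq_bigr do rewrite -natrM.
  rewrite -natr_sum ler_nat (bigD1 i) //= eqxx mul0n add0n.
  rewrite (eq_bigr (fun j => (tokens xi i + tokens zeta j)%N)); last first.
    by move=> j ->; rewrite mul1n.
  rewrite big_split /= sum_nat_const.
  have -> : (#|[pred j : 'I_k | j != i]| = k.-1)%N by rewrite cardC1 card_ord.
  have k0 : (0 < k)%N by exact: leq_ltn_trans (ltn_ord i).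
  have tz : (\sum_(j < k | j != i) tokens zeta j <= n)%N.
    by rewrite -[leqRHS](sum_tokens zeta) [leqRHS](bigD1 i) //= leq_addl.
  rewrite -[X in (_ <= X * n)%N](prednK k0) mulSn addnC.
  by apply: leq_add => //; apply: leq_mul => //; exact: tokens_le.
pose X : R := (k * n)%:R / (q * u) ^+ 2; rewrite -/X in bound *.
have r1 : `|1 - q / 2| < 1.
  have := die_prob_le1 p_gt0 p1 i; have := qp i => qi p_i1.
  by rewrite ger0_norm; lra.
(* Longer words remove the contribution of undecided races. *)
have lim : 1 - 2 * (X + C * (1 - q / 2) ^+ m) @[m --> \oo] --> 1 - 2 * X.
  rewrite -{2}[X]addr0; apply: cvgB; first exact: cvg_cst.
  apply: cvgM; first exact: cvg_cst.
  by apply: cvgD; [exact: cvg_cst|exact: cvg_geometric].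
by apply: (cvgr_to_le lim); apply: nearW => m; exact: bound.
Qed.
End Gap.

(** * The numerical threshold *)

Theorem theorem1p2 (R : realType) (d : measure_display)
    (Omega : measurableType d) (P : probability Omega R)
    (k n : nat) (p : 'I_k -> R)
    (W : nat -> {RV P >-> R}) (D : nat -> Omega -> 'I_k)
    (alpha : allocation k n -> R) :
  (0 < k)%N -> (0 < n)%N ->
  (forall i, 0 < p i) -> \sum_(i < k) p i = 1 ->
  die_at_poisson_times p W D ->
  optimal W D alpha ->
  \sum_(xi : allocation k n |
      overplay p xi > (3 * Num.sqrt (3 + Num.sqrt 5) * Num.sqrt (k * n)%:R + 1)
                      / min_over p) alpha xi = 0.
Proof.
move=> k0 n0 p0 p1 dieP [[a0 a1] opt].
have [i0 qE qp] := min_over_attained p k0; rewrite -qE in qp.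
have q0 : 0 < min_over p by rewrite qE.
move: (min_over p) q0 qp => q q0 qp {qE i0}.
apply: big1 => xi; set lam := Num.sqrt (3 + _); set s := Num.sqrt _%:R => big.
have [eta etaP] := balanced_allocation n p0 p1.
(* Chosen so that [xi] lies exactly three steps of size [u] above the bound [q^-1] for [eta]. *)
pose u := (overplay p xi - q^-1) / 3.
have u_gt : lam * s / q < u.
  have e : lam * s / q * 3 = 3 * lam * s / q by ring.
  rewrite ltr_pdivlMr // ltrBrDr e.
  by move: big; rewrite mulrDl mul1r.
have s0 : 0 < s by rewrite sqrtr_gt0 ltr0n muln_gt0 k0.
have s5 : Num.sqrt 5 ^+ 2 = 5 :> R by rewrite sqr_sqrtr.
have s50 : 0 <= Num.sqrt 5 :> R by exact: sqrtr_ge0.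
have lam0 : 0 < lam by rewrite sqrtr_gt0; lra.
have lam2 : lam ^+ 2 = 3 + Num.sqrt 5 by rewrite sqr_sqrtr //; lra.
have s2 : s ^+ 2 = (k * n)%:R by rewrite sqr_sqrtr.
have u0 : 0 < u by apply: lt_trans u_gt; rewrite divr_gt0 // mulr_gt0.
pose x : R := (k * n)%:R / (q * u) ^+ 2.
have x0 : 0 <= x by rewrite divr_ge0 // sqr_ge0.
have x_lt : x * (3 + Num.sqrt 5) < 1.
  rewrite /x mulrAC ltr_pdivrMr; last by rewrite exprn_gt0 // mulr_gt0.
  have ls : s * lam < q * u.
    by move: u_gt; rewrite ltr_pdivrMr // mulrC [u * q]mulrC.
  have sl0 : 0 <= s * lam by rewrite ltW // mulr_gt0.
  rewrite mul1r -s2 -lam2 -exprMn ltr_pXn2r // nnegrE ltW //.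
  exact: le_lt_trans ls.
(* Since [2 / (3 + sqrt 5) = (3 - sqrt 5) / 2], [x_lt] says that [1 - 2 * x] exceeds
   [(sqrt 5 - 1) / 2], the positive root of [y ^+ 2 + y = 1]. *)
have y0 : 0 < 1 - 2 * x by nra.
have y1 : 1 < (1 - 2 * x) ^+ 2 + (1 - 2 * x) by nra.
pose M (z y : allocation k n) := win_prob W D z y - win_prob W D y z.
apply: (@skew_game_overplay _ _ M (overplay p) alpha u (1 - 2 * x) q^-1 eta)
  => //.
- by move=> z y; rewrite /M opprB.
- move=> z y; rewrite /M lerBlDr; apply: le_trans (win_prob_le1 W D z y) _.
  by rewrite lerDl win_prob_ge0.
(* A pure strategy with positive payoff against [alpha] would refute optimality. *)
- move=> z; rewrite leNgt; apply/negP => Mz; apply: opt.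
  exists (fun y => (y == z)%:R); split.
    split=> [y //|]; rewrite (bigD1 z) //= eqxx big1 ?addr0 // => y /negbTE.
    by move=> ->.
  rewrite pr_beats_purel pr_beats_purer -subr_gt0 -sumrB.
  by under eq_bigr do rewrite -mulrBr.
- move=> zeta xi' gap.
  have [i oxi _] := max_over_attained
    (fun i => (tokens xi' i)%:R / p i - n%:R) k0.
  have [j ozeta zeta_le] := max_over_attained
    (fun i => (tokens zeta i)%:R / p i - n%:R) k0.
  apply: (win_prob_overplay dieP p0 p1 (i := i) q0 u0 qp) => l.
  have := zeta_le l; rewrite /overplay ozeta oxi in gap; lra.
- have [i oeta _] := max_over_attained
    (fun i => (tokens eta i)%:R / p i - n%:R) k0.
  rewrite /overplay oeta.
  apply: (@le_trans _ _ (p i)^-1); last by rewrite lef_pV2 ?posrE.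
  by rewrite lerBlDr ler_pdivrMr // mulrDl mulVf ?gt_eqF // addrC.
- by rewrite /u; field; rewrite gt_eqF.
Qed.
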